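(* Let $\alpha<0$. Then none of the zeros of any optimal polynomial approximant to $1/f$ in the space $D_\alpha$ ($f\in D_\alpha$, $f(0)\neq0$), and hence none of the zeros of the corresponding weighted reproducing kernels $k_n(z,0)$, lie inside the open disk $\{z:|z|<(3/2)^{\alpha/2}\}$.
   Context: $D_\alpha$ is the Hilbert space of functions $f(z)=\sum_{n\ge0}a_nz^n$ analytic in the open unit disk with $\|f\|^2=\sum_{n\ge0}|a_n|^2(n+1)^\alpha<\infty$ and inner product $\langle\sum a_nz^n,\sum b_nz^n\rangle=\sum a_n\overline{b_n}(n+1)^\alpha$. $\mathcal{P}_n$ is the space of polynomials of degree at most $n$. The optimal polynomial approximant of order $n$ to $1/f$ is the unique $p_n\in\mathcal{P}_n$ minimizing $\|pf-1\|$ over $p\in\mathcal{P}_n$. The weighted reproducing kernel $k_n(z,w)$ is the reproducing kernel of $\mathcal{P}_n$ with inner product $\langle g,h\rangle_f:=\langle gf,hf\rangle$; when $f(0)\ne0$, $p_n(z)=\overline{f(0)}\,k_n(z,0)$. *)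

(* Defs.v *)
From mathcomp Require Import all_boot all_order all_algebra.
From mathcomp Require Import complex.
From mathcomp Require Import all_classical all_reals all_analysis.

Set Implicit Arguments.
Unset Strict Implicit.
Unset Printing Implicit Defensive.

Import Order.TTheory GRing.Theory Num.Theory.
Import numFieldNormedType.Exports.

Local Open Scope classical_set_scope.
Local Open Scope ring_scope.

(* Topological and normed structures are inferred from an abstract number field,
   not from the type [R[i]]; hence this packaging as a [numClosedFieldType]. *)
Definition Cplx (R : realType) : numClosedFieldType := R[i].

(* The modulus as an element of [R]; the generic norm [`|z|] lives in [R[i]]. *)
Definition modc (R : realType) (z : Cplx R) : R := complex.Re `|z|.

(* [f] is analytic in the open unit disk, with Taylor coefficients [a] at 0.
   Values of [f] outside of the open unit disk are irrelevant throughout. *)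
Definition has_taylor (R : realType) (f : Cplx R -> Cplx R)
    (a : (Cplx R)^nat) : Prop :=
  forall z : Cplx R, modc z < 1 ->
    series (fun k => a k * z ^+ k) @ \oo --> f z.

(* Meaningful when [f] is analytic in the open unit disk (the sequence is then
   unique); the zero sequence otherwise. *)
Definition taylor (R : realType) (f : Cplx R -> Cplx R) : (Cplx R)^nat :=
  xget (fun _ => 0) [set a | has_taylor f a].

Definition weight (R : realType) (alpha : R) (k : nat) : R :=
  k.+1%:R `^ alpha.

Definition Dterm (R : realType) (alpha : R) (f : Cplx R -> Cplx R) : R^nat :=
  fun k => modc (taylor f k) ^+ 2 * weight alpha k.

Definition Dspace (R : realType) (alpha : R) : set (Cplx R -> Cplx R) :=
  [set f | has_taylor f (taylor f) /\ cvgn (series (Dterm alpha f))].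

Definition Dnorm (R : realType) (alpha : R) (f : Cplx R -> Cplx R) : R :=
  Num.sqrt (limn (series (Dterm alpha f))).

Definition Ddot (R : realType) (alpha : R) (f g : Cplx R -> Cplx R) : Cplx R :=
  limn (series (fun k =>
    taylor f k * (taylor g k)^* * (weight alpha k)%:C%C : Cplx R)).

Definition Pspace (R : realType) (n : nat) : set (Cplx R -> Cplx R) :=
  [set p | exists2 q : {poly Cplx R}, (size q <= n.+1)%N & p = horner q].

Definition is_opt_approximant (R : realType) (alpha : R)
    (f : Cplx R -> Cplx R) (n : nat) (p : Cplx R -> Cplx R) : Prop :=
  Pspace n p /\
  forall q : Cplx R -> Cplx R, Pspace n q ->
    Dnorm alpha (fun z => p z * f z - 1) <= Dnorm alpha (fun z => q z * f z - 1).

Definition wdot (R : realType) (alpha : R) (f g h : Cplx R -> Cplx R) : Cplx R :=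
  Ddot alpha (fun z => g z * f z) (fun z => h z * f z).

Definition is_weighted_kernel (R : realType) (alpha : R)
    (f : Cplx R -> Cplx R) (n : nat) (k : Cplx R -> Cplx R -> Cplx R) : Prop :=
  forall w : Cplx R,
    Pspace n (k^~ w) /\
    forall g : Cplx R -> Cplx R, Pspace n g -> wdot alpha f g (k^~ w) = g w.

(* Main.v *)
Require Import Defs.
From mathcomp Require Import all_boot all_order all_algebra.
From mathcomp Require Import complex.
From mathcomp Require Import all_classical all_reals all_analysis.
From mathcomp Require Import ring lra.

(** Let P be the approximant (or the kernel), z a zero of P, P = ('X - z) Q and
    g = Q f = sum b_k X^k. Testing the extremal property (or the reproducing
    property) against X Q gives <X g, (X - z) g> = 0 up to a constant term that
    X g does not see, so z <g - g(0), X g> = |X g|^2 and hence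
    |X g| <= |z| |g - g(0)|. Since the weights satisfy
    w_(k+1) >= (3/2)^alpha w_k for k >= 1, the inequality |z|^2 < (3/2)^alpha
    would force g = 0, which f(0) != 0 excludes. Only real parts of inner
    products are used, i.e. the test polynomials are perturbed along the reals. *)

Set Implicit Arguments.
Unset Strict Implicit.
Unset Printing Implicit Defensive.

Import Order.TTheory GRing.Theory Num.Theory.
Import numFieldNormedType.Exports.

Local Open Scope classical_set_scope.
Local Open Scope ring_scope.

(** * Series with a prescribed sum *)

Section Sums.
Variable K : numFieldType.
Implicit Types (u v : K^nat) (a b : K).

(** A relation, so that convergence and value are carried together; [limn] alone has a default value
    on divergent series. *)
Definition sums u a := series u @ \oo --> a.

Lemma sumsD u v a b : sums u a -> sums v b -> sums (fun k => u k + v k) (a + b).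
Proof.
by move=> ua vb; rewrite /sums (seriesD u v); exact: cvgD ua vb.
Qed.

Lemma sumsZ c u a : sums u a -> sums (fun k => c * u k) (c * a).
Proof.
move=> ua; rewrite /sums.
rewrite (_ : series _ = fun n => c * series u n); last first.
  by apply/funext => n; rewrite /series /= mulr_sumr.
exact: cvgMl_tmp.
Qed.

Lemma sums_unique u a b : sums u a -> sums u b -> a = b.
Proof. by move=> ua ub; apply: (cvg_unique (@norm_hausdorff K K) ua ub). Qed.

Lemma sums_lim u a : sums u a -> limn (series u) = a.
Proof. exact: (cvg_lim (@norm_hausdorff K K)). Qed.

Lemma sumsS u a : sums (fun k => u k.+1) a <-> sums u (u 0%N + a).
Proof.
suff E n : series u n.+1 = u 0%N + series (fun k => u k.+1) n.
  split => h.
    rewrite /sums -cvg_shiftS.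
    rewrite (_ : [sequence _]_n = fun n => u 0%N + series (fun k => u k.+1) n).
      by apply: cvgD => //; exact: cvg_cst.
    by apply/funext => n /=; exact: E.
  rewrite /sums (_ : series _ = fun n => series u n.+1 - u 0%N); last first.
    by apply/funext => n; rewrite E addrC addKr.
  rewrite -[X in _ --> X](addKr (u 0%N)) addrC.
  apply: cvgB; last exact: cvg_cst.
  by rewrite cvg_shiftS.
by rewrite /series /= big_nat_recl.
Qed.

Lemma sums_delta a : sums (fun k => if k is 0%N then a else 0) a.
Proof.
rewrite -[X in sums _ X]addr0; apply/(sumsS (fun k => if k is 0%N then a else 0)).
rewrite /sums (_ : series _ = cst 0); first exact: cvg_cst.
by apply/funext => n; rewrite /series /= big1.
Qed.

End Sums.

Arguments sumsZ {K} c {u a}.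
Arguments sums_delta {K} a.

(** * Real series: nonnegative terms and comparison *)

Section RealSums.
Variable R : realType.
Implicit Types (u v : R^nat) (a b : R).

Lemma sums_ge0_eq0 u : (forall k, 0 <= u k) -> sums u 0 -> forall k, u k = 0.
Proof.
move=> u0 su k; apply/eqP; rewrite eq_le u0 andbT.
have ndu : {homo series u : n m / (n <= m)%N >-> n <= m}.
  by apply/nondecreasing_series.
have cu : cvgn (series u) by apply/cvg_ex; exists 0.
have := nondecreasing_cvgn_le ndu cu k.+1.
rewrite (sums_lim su); apply: le_trans.
rewrite /series /= big_nat_recr //= lerDr.
by rewrite sumr_ge0.
Qed.

Lemma norm_le_cvg_series u v : (forall k, `|u k| <= v k) ->
  cvgn (series v) -> cvgn (series u).
Proof.
move=> uv cv; apply: normed_cvg; apply: (series_le_cvg _ _ _ cv) => k //=.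
exact: le_trans (normr_ge0 _) (uv k).
Qed.

End RealSums.

(** * The modulus, and the Euclidean inner product on the complex plane *)

Section Modulus.
Variable R : realType.
Implicit Types x y z : Cplx R.

Lemma modcE z : (modc z)%:C%C = `|z|.
Proof. by rewrite /modc; case: z => a b. Qed.

Lemma modc_sq z : modc z ^+ 2 = complex.Re z ^+ 2 + complex.Im z ^+ 2.
Proof.
case: z => a b; rewrite /modc /= sqr_sqrtr //.
by rewrite addr_ge0 // sqr_ge0.
Qed.

Lemma modc_ge0 z : 0 <= modc z.
Proof. by case: z => a b; rewrite /modc /= sqrtr_ge0. Qed.

Lemma modc0 : modc (0 : Cplx R) = 0.
Proof. by rewrite /modc normr0. Qed.

Lemma modc_eq0 z : (modc z == 0) = (z == 0).
Proof. by rewrite -(inj_eq (@complexI R)) modcE normr_eq0. Qed.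

Definition rdot x y : R := complex.Re (x * y^*).

Lemma rdotE x y :
  rdot x y = complex.Re x * complex.Re y + complex.Im x * complex.Im y.
Proof. by case: x y => a b [c d]; rewrite /rdot /=; ring. Qed.

End Modulus.

(** * The weights and their consecutive ratios *)

Section Weights.
Variables (R : realType) (alpha : R).
Hypothesis alpha_lt0 : alpha < 0.

Lemma powR_antitone (x y : R) : 0 < x -> x <= y -> y `^ alpha <= x `^ alpha.
Proof.
move=> x0 xy; have y0 := lt_le_trans x0 xy.
rewrite -[alpha]opprK !(powRN _ (- alpha)) lef_pV2 ?posrE ?powR_gt0 //.
by apply: ge0_ler_powR => //; rewrite ?nnegrE ?oppr_ge0 ltW.
Qed.

Lemma weight_gt0 k : 0 < weight alpha k.
Proof. by rewrite powR_gt0. Qed.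

Lemma weight_decr k : weight alpha k.+1 <= weight alpha k.
Proof. by apply: powR_antitone => //; rewrite ler_nat. Qed.

(** The ratio (k+3)/(k+2) is at most 3/2, with equality at k = 0, and the negative exponent reverses
    the inequality. The weights start at index 1: from index 0 to 1 the ratio would only be
    2^alpha. *)
Lemma weight_ratio k : (3 / 2) `^ alpha * weight alpha k.+1 <= weight alpha k.+2.
Proof.
rewrite /weight -powRM //.
apply: powR_antitone => //.
rewrite -[k.+3]addn2 -[k.+2]addn1 -addn1 !natrD.
have : (0 : R) <= k%:R by [].
lra.
Qed.

Lemma lt_powR_half_sq (r : R) : 0 <= r -> r < (3 / 2) `^ (alpha / 2) ->
  r ^+ 2 < (3 / 2) `^ alpha.
Proof.
move=> r0 h; have -> : alpha = alpha / 2 * 2%:R by field.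
by rewrite powRrM powR_mulrn ?powR_ge0 // ltr_pXn2r ?nnegrE ?powR_ge0.
Qed.

End Weights.

(** * Uniqueness of Taylor coefficients *)

Section Taylor.
Variable R : realType.
Implicit Types (x y z : Cplx R) (a b c : (Cplx R)^nat) (f g : Cplx R -> Cplx R).

Lemma modcD x y : modc (x + y) <= modc x + modc y.
Proof. by rewrite -lecR rmorphD /= !modcE ler_normD. Qed.

Lemma modcN x : modc (- x) = modc x.
Proof. by rewrite /modc normrN. Qed.

Lemma modcM x y : modc (x * y) = modc x * modc y.
Proof. by apply: complexI; rewrite rmorphM /= !modcE normrM. Qed.

Lemma modcX x n : modc (x ^+ n) = modc x ^+ n.
Proof.
elim: n => [|n IH]; first by rewrite !expr0 /modc normr1.
by rewrite !exprS modcM IH.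
Qed.

Lemma modcR (r : R) : 0 <= r -> modc (r%:C%C : Cplx R) = r.
Proof. by move=> r0; rewrite /modc ger0_norm // ler0c. Qed.

(** For small z the tail of the series is too small to cancel c_0. The point z = 0 is left out of
    the hypothesis so that the lemma can be iterated after division by z. *)
Lemma null_power_series_coef0 c :
  (forall z, z != 0 -> modc z < 1 -> sums (fun k => c k * z ^+ k) 0) -> c 0%N = 0.
Proof.
move=> hc; apply/eqP; case: eqVneq => // c0.
pose e := modc (c 0%N).
have e0 : 0 < e.
  by rewrite lt_def modc_ge0 andbT modc_eq0.
pose h : Cplx R := (2^-1 : R)%:C%C.
have hh : modc h = 2^-1 by rewrite modcR // invr_ge0.
(* Convergence at z = 1/2 bounds the terms there, whence the growth bound on the coefficients. *)
have [M M0 cM] : exists2 M, 0 < M & forall k, modc (c k) <= M * 2 ^+ k.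
  have : sums (fun k => c k * h ^+ k) 0.
    apply: hc; last by rewrite hh; lra.
    by rewrite -modc_eq0 hh gt_eqF // invr_gt0.
  move=> sh; have ch : cvgn (series (fun k => c k * h ^+ k)) by apply/cvg_ex; exists 0.
  have /(@cvgP _ _ _)/cvg_seq_bounded := cvg_series_cvg_0 ch.
  move=> /ex_strict_bound_gt0[M M0 MP]; exists (complex.Re M).
    by move: M0; rewrite ltcE /= => /andP[].
  move=> k; have : modc (c k * h ^+ k) < complex.Re M.
    by have := MP k I; rewrite /= ltcE => /andP[].
  rewrite modcM modcX hh exprVn => /ltW.
  by rewrite ler_pdivrMr // exprn_gt0.
(* At z = s/2 the tail is at most M s (1 + s + ...) <= 2 M s; this s makes 2 M s < e/2, and s <= 1/2
   bounds the geometric sum by 2. *)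
pose s := e / (4 * M + 2 * e).
have D0 : 0 < 4 * M + 2 * e by lra.
have s0 : 0 < s by rewrite divr_gt0.
have s2 : s <= 2^-1 by rewrite ler_pdivrMr //; lra.
pose z : Cplx R := (s / 2)%:C%C.
have mz : modc z = s / 2 by rewrite modcR // divr_ge0 // ltW.
have z0 : z != 0 by rewrite -modc_eq0 mz gt_eqF // divr_gt0.
have z1 : modc z < 1 by rewrite mz; lra.
have geo n : \sum_(0 <= k < n) s ^+ k <= 2.
  elim: n => [|n IH]; first by rewrite big_nil.
  rewrite big_nat_recl //= expr0.
  under eq_bigr do rewrite exprS.
  rewrite -mulr_sumr.
  have : s * (\sum_(0 <= k < n) s ^+ k) <= s * 2 by rewrite ler_pM2l.
  lra.
have tail n : modc (\sum_(0 <= k < n) c k.+1 * z ^+ k.+1) <= M * s * \sum_(0 <= k < n) s ^+ k.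
  elim: n => [|n IH]; first by rewrite !big_nil modc0 mulr0.
  rewrite !big_nat_recr //= mulrDr; apply: le_trans (modcD _ _) _; apply: lerD => //.
  rewrite modcM modcX mz expr_div_n -[M * s * _]mulrA -exprS mulrA.
  rewrite ler_pdivrMr ?exprn_gt0 //.
  by rewrite mulrAC ler_pM2r ?exprn_gt0.
have := hc z z0 z1; rewrite /sums -cvg_shiftS => /cvgr_norm_lt /(_ (e / 2)%:C%C).
rewrite normr0 ltcR divr_gt0 // => /(_ isT) [N _ /(_ N (leqnn _)) /=].
rewrite -modcE ltcR /series /= big_nat_recl // expr0 mulr1 => h1.
have h2 : e <= modc (c 0%N + \sum_(0 <= i < N) c i.+1 * z ^+ i.+1)
      + modc (\sum_(0 <= i < N) c i.+1 * z ^+ i.+1).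
  by rewrite -[X in _ + X]modcN; apply: le_trans (modcD _ _); rewrite addrK.
have h3 := tail N.
have h4 : M * s * (\sum_(0 <= k < N) s ^+ k) <= M * s * 2 by rewrite ler_pM2l // mulr_gt0.
have h5 : M * s * 2 < e / 2.
  rewrite -subr_gt0.
  have -> : e / 2 - M * s * 2 = e ^+ 2 / (4 * M + 2 * e).
    by rewrite /s; field; rewrite gt_eqF.
  by rewrite divr_gt0 // exprn_gt0.
lra.
Qed.

(** Once c_0 = 0, dividing by z gives a series of the same kind with shifted coefficients. *)
Lemma null_power_series c :
  (forall z, z != 0 -> modc z < 1 -> sums (fun k => c k * z ^+ k) 0) ->
  forall k, c k = 0.
Proof.
move=> hc k; elim: k c hc => [|k IH] c hc; first exact: null_power_series_coef0.
apply: (IH (fun k => c k.+1)) => z z0 z1.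
have c0 := null_power_series_coef0 hc.
have /(sumsZ z^-1) : sums (fun k => c k.+1 * z ^+ k.+1) 0.
  by apply/(sumsS (fun k => c k * z ^+ k)); rewrite c0 mul0r add0r; exact: hc.
rewrite mulr0; congr (sums _ _); apply/funext => j.
by rewrite exprS mulrCA mulKf.
Qed.

Lemma has_taylor_unique f a b : has_taylor f a -> has_taylor f b -> a = b.
Proof.
move=> fa fb; apply/funext => k; apply/eqP; rewrite -subr_eq0; apply/eqP.
apply: (@null_power_series (fun k => a k - b k)) => z _ z1.
have := sumsD (fa z z1) (sumsZ (-1) (fb z z1)); rewrite mulN1r subrr.
by congr (sums _ _); apply/funext => j; rewrite mulN1r mulrBl.
Qed.

Lemma taylorE f a : has_taylor f a -> taylor f = a.
Proof.
move=> fa; apply: (@has_taylor_unique f) => //.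
by rewrite /taylor; case: xgetP => [b _ //|/(_ a)].
Qed.

End Taylor.

(** * Complex series from their real and imaginary parts *)

Section ComplexSums.
Variable R : realType.

Definition iC : Cplx R := (0 +i* 1)%C.

Lemma sums_real_complex (r : R^nat) (l : R) :
  sums r l -> sums (fun k => (r k)%:C%C : Cplx R) l%:C%C.
Proof.
move=> rl; apply/cvgrPdist_lt => e e0.
(* A positive element of [R[i]] is real, so the tolerance comes from [R]. *)
have eE : e = (complex.Re e)%:C%C.
  by case: e e0 => p q; rewrite ltcE /= => /andP[/eqP -> _].
have {e0} : 0 < complex.Re e by rewrite -ltcR -eE.
move=> /(proj1 (cvgrPdist_lt _ _) rl); apply: filterS => n.
rewrite [in X in _ -> X]eE -modcE ltcR; congr (_ < _).
have -> : series (fun k => (r k)%:C%C : Cplx R) n = (series r n)%:C%C.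
  by rewrite /series /= rmorph_sum.
by rewrite -rmorphB /= /modc normc_def /= expr0n addr0 sqrtr_sqr.
Qed.

Lemma sums_complex (r s : R^nat) (a b : R) : sums r a -> sums s b ->
  sums (fun k => (r k +i* s k)%C : Cplx R) (a +i* b)%C.
Proof.
move=> ra sb.
have E (p q : R) : (p +i* q)%C = p%:C%C + iC * q%:C%C :> Cplx R.
  by apply/eqP; rewrite eq_complex /=; apply/andP; split; apply/eqP; ring.
rewrite E; have := sumsD (sums_real_complex ra) (sumsZ iC (sums_real_complex sb)).
by congr (sums _ _); apply/funext => k; rewrite E.
Qed.

End ComplexSums.

(** * The space on the side of coefficients, and orthogonality *)

Section Dalpha.
Variables (R : realType) (alpha : R).
Hypothesis alpha_lt0 : alpha < 0.
Implicit Types (x y z : Cplx R) (a b c u v : (Cplx R)^nat).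
Implicit Types (f g : Cplx R -> Cplx R) (P Q : {poly Cplx R}).

Let w := weight alpha.

Definition ell2 a := cvgn (series (fun k => modc (a k) ^+ 2 * w k)).

Definition sqnorm a : R := limn (series (fun k => modc (a k) ^+ 2 * w k)).

(** Multiplication of a function by its variable, on Taylor coefficients. *)
Definition shift a : (Cplx R)^nat := fun k => if k is j.+1 then a j else 0.

Definition delta : (Cplx R)^nat := fun k => if k is 0%N then 1 else 0.

Lemma weight_ge0 k : 0 <= w k. Proof. by rewrite ltW // weight_gt0. Qed.

Lemma term_ge0 z k : 0 <= modc z ^+ 2 * w k.
Proof. by rewrite mulr_ge0 ?sqr_ge0 ?weight_ge0. Qed.

Lemma ell2D a b : ell2 a -> ell2 b -> ell2 (fun k => a k + b k).
Proof.
move=> ha hb; have := sumsD (sumsZ 2 ha) (sumsZ 2 hb).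
move=> /(@cvgP _ _ _); apply: norm_le_cvg_series => k.
rewrite ger0_norm ?term_ge0 //.
rewrite [2 * (modc (a k) ^+ 2 * _)]mulrA [2 * (modc (b k) ^+ 2 * _)]mulrA -mulrDl.
rewrite ler_wpM2r ?weight_ge0 // !modc_sq.
case: (a k) (b k) => p q [r s] /=; rewrite -subr_ge0.
have -> : 2 * (p ^+ 2 + q ^+ 2) + 2 * (r ^+ 2 + s ^+ 2) -
  ((p + r) ^+ 2 + (q + s) ^+ 2) = (p - r) ^+ 2 + (q - s) ^+ 2 by ring.
by rewrite addr_ge0 // sqr_ge0.
Qed.

Lemma ell2Z z a : ell2 a -> ell2 (fun k => z * a k).
Proof.
move=> ha; have /(@cvgP _ _ _) := sumsZ (modc z ^+ 2) ha.
rewrite /ell2; under [in X in _ -> X]eq_fun do rewrite modcM exprMn -mulrA.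
by [].
Qed.

(** The weights decrease because alpha < 0, so shifting shrinks each weighted term. *)
Lemma ell2_shift a : ell2 a -> ell2 (shift a).
Proof.
move=> ha.
have hl : cvgn (series (fun k => modc (a k) ^+ 2 * w k.+1)).
  apply: norm_le_cvg_series ha => k.
  rewrite ger0_norm ?term_ge0 //.
  by rewrite ler_wpM2l ?sqr_ge0 // weight_decr.
set l := limn _ in hl; apply/cvg_ex; exists (0 + l).
rewrite -[X in (X + _)](mul0r (w 0)) -[X in (X * _ + _)](expr0n R 2) -modc0.
exact/(sumsS (fun k => modc (shift a k) ^+ 2 * w k)).
Qed.

Lemma ell2_delta : ell2 delta.
Proof.
apply/cvg_ex; exists (w 0); have := sums_delta (w 0).
congr (sums _ _); apply/funext => -[|k] /=; last by rewrite modc0 expr0n mul0r.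
by rewrite /modc normr1 expr1n mul1r.
Qed.

Lemma sqnorm_ge0 a : ell2 a -> 0 <= sqnorm a.
Proof.
move=> ha; apply: limr_ge => //; apply: nearW => n.
by apply: sumr_ge0 => k _; rewrite term_ge0.
Qed.

Lemma ell2_rdot a b : ell2 a -> ell2 b ->
  cvgn (series (fun k => rdot (a k) (b k) * w k)).
Proof.
move=> ha hb; have /(@cvgP _ _ _) := sumsD ha hb.
apply: norm_le_cvg_series => k; rewrite normrM [`|w k|]ger0_norm ?weight_ge0 //.
rewrite -mulrDl ler_wpM2r ?weight_ge0 // rdotE !modc_sq.
case: (a k) (b k) => p q [r s] /=.
have := (sqr_ge0 (p + r), sqr_ge0 (q + s), sqr_ge0 (p - r), sqr_ge0 (q - s)).
have := (sqr_ge0 p, sqr_ge0 q, sqr_ge0 r, sqr_ge0 s).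
move=> [[[hp hq] hr] hs] [[[h1 h2] h3] h4].
by rewrite ler_norml; apply/andP; split; nra.
Qed.

(** The difference of the two squared norms is 2 t S + t^2 V, with S the real inner product and V
    the squared norm of v; it is nonnegative for all real t only if S = 0. *)
Lemma variation u v : ell2 u -> ell2 v ->
  (forall t : R, sqnorm u <= sqnorm (fun k => u k + t%:C%C * v k)) ->
  sums (fun k => rdot (u k) (v k) * w k) 0.
Proof.
move=> hu hv hmin; have hs := ell2_rdot hu hv.
set S := limn (series (fun k => rdot (u k) (v k) * w k)) in hs.
suff <- : S = 0 by [].
have V0 := sqnorm_ge0 hv; set V := sqnorm v in V0.
have quad (t : R) : 0 <= 2 * t * S + t ^+ 2 * V.
  have := hmin t; rewrite -subr_ge0; congr (_ <= _).
  suff -> : sqnorm (fun k => u k + t%:C%C * v k) = sqnorm u + (2 * t * S + t ^+ 2 * V).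
    by rewrite addrC addKr.
  apply: sums_lim.
  have := sumsD hu (sumsD (sumsZ (2 * t) hs) (sumsZ (t ^+ 2) hv)).
  congr (sums _ _); apply/funext => k; rewrite rdotE !modc_sq.
  by case: (u k) (v k) => p q [r s] /=; ring.
apply/eqP; case: eqVneq => // S0.
(* The minimizer would be -S/V; V + 1 avoids the case V = 0 and still gives a negative value. *)
have := quad (- S / (V + 1)).
have -> : 2 * (- S / (V + 1)) * S + (- S / (V + 1)) ^+ 2 * V =
    - (S ^+ 2 * (V + 2) / (V + 1) ^+ 2).
  by field; rewrite gt_eqF //; lra.
rewrite oppr_ge0 leNgt divr_gt0 ?exprn_gt0 //; last lra.
by rewrite mulr_gt0 ?exprn_even_gt0 //; lra.
Qed.

(** Membership in the space with an explicit coefficient sequence, in place of the one chosen by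
    [taylor]. *)
Definition inD f a := has_taylor f a /\ ell2 a.

Lemma inDD f g a b : inD f a -> inD g b -> inD (fun z => f z + g z) (fun k => a k + b k).
Proof.
move=> [fa a2] [gb b2]; split; last exact: ell2D.
move=> z z1; have := sumsD (fa z z1) (gb z z1).
by congr (sums _ _); apply/funext => k; rewrite mulrDl.
Qed.

Lemma inDZ x f a : inD f a -> inD (fun z => x * f z) (fun k => x * a k).
Proof.
move=> [fa a2]; split; last exact: ell2Z.
move=> z z1; have := sumsZ x (fa z z1).
by congr (sums _ _); apply/funext => k; rewrite mulrA.
Qed.

Lemma inDX f a : inD f a -> inD (fun z => z * f z) (shift a).
Proof.
move=> [fa a2]; split; last exact: ell2_shift.
move=> z z1; rewrite -[z * f z]add0r.
have -> : 0 = shift a 0 * z ^+ 0 :> Cplx R by rewrite mul0r.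
apply/(sumsS (fun k => shift a k * z ^+ k)).
have := sumsZ z (fa z z1).
by congr (sums _ _); apply/funext => k; rewrite exprS mulrCA.
Qed.

Lemma inD1 : inD (fun=> 1) delta.
Proof.
split; last exact: ell2_delta.
move=> z z1; have := sums_delta (1 : Cplx R).
by congr (sums _ _); apply/funext => -[|k] /=; rewrite ?mul1r ?mul0r.
Qed.

Lemma inD_eq f g a : f =1 g -> inD f a -> inD g a.
Proof. by move=> /funext ->. Qed.

(** Horner induction: the space is stable under multiplication by the variable and under linear
    combinations. *)
Lemma inD_poly f a P : inD f a -> exists b, inD (fun z => P.[z] * f z) b.
Proof.
move=> fa; elim/poly_ind: P => [|P c [b hb]].
  exists (fun k => 0 * a k); apply: inD_eq (inDZ 0 fa) => z.
  by rewrite horner0.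
exists (fun k => shift b k + c * a k).
apply: inD_eq (inDD (inDX hb) (inDZ c fa)) => z.
by rewrite hornerMXaddC mulrDl mulrA [z * _]mulrC.
Qed.

Lemma inD_taylor f a : inD f a -> taylor f = a.
Proof. by case=> fa _; exact: taylorE. Qed.

Lemma inD_at0 f a : inD f a -> a 0%N = f 0.
Proof.
move=> [fa _]; apply: (@sums_unique (Cplx R) _ _ _ (sums_delta (a 0%N))).
have : modc (0 : Cplx R) < 1 by rewrite modc0.
move=> /(fa 0); congr (sums _ _); apply/funext => -[|k].
  by rewrite expr0 mulr1.
by rewrite expr0n mulr0.
Qed.

Lemma Dnorm_le f g a b : inD f a -> inD g b ->
  Dnorm alpha f <= Dnorm alpha g -> sqnorm a <= sqnorm b.
Proof.
move=> fa gb; rewrite /Dnorm /Dterm (inD_taylor fa) (inD_taylor gb).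
by rewrite ler_psqrt // nnegrE; apply: sqnorm_ge0; [case: fa|case: gb].
Qed.

Lemma Ddot_Re f g a b : inD f a -> inD g b ->
  sums (fun k => rdot (a k) (b k) * w k) (complex.Re (Ddot alpha f g)).
Proof.
move=> fa gb; rewrite /Ddot (inD_taylor fa) (inD_taylor gb).
have [a2 b2] := (proj2 fa, proj2 gb).
(* The imaginary part of a times the conjugate of b is [rdot] of a and i b. *)
have h1 := ell2_rdot a2 b2; have h2 := ell2_rdot a2 (ell2Z (z := iC R) b2).
have := sums_complex h1 h2.
set l := limn _ in h1 *; set l' := limn _ => hl.
suff -> : limn (series (fun k => a k * (b k)^* * (weight alpha k)%:C%C : Cplx R)) =
  (l +i* l')%C by [].
apply: sums_lim; move: hl; congr (sums _ _); apply/funext => k.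
rewrite !rdotE /w; case: (a k) (b k) => p q [r s].
by apply/eqP; rewrite eq_complex /=; apply/andP; split; apply/eqP; ring.
Qed.

(** P + t Q remains admissible for every real t, so the residual P f - 1 is stationary in the
    direction Q f. *)
Lemma opt_orthogonal f n P Q u v :
  is_opt_approximant alpha f n (horner P) ->
  (size P <= n.+1)%N -> (size Q <= n.+1)%N ->
  inD (fun z => P.[z] * f z - 1) u -> inD (fun z => Q.[z] * f z) v ->
  sums (fun k => rdot (u k) (v k) * w k) 0.
Proof.
move=> [_ opt] sP sQ hu hv; apply: variation => [||t]; [by case: hu|by case: hv|].
apply: (Dnorm_le hu _ (opt (horner (P + t%:C%C *: Q)) _)).
  apply: inD_eq (inDD hu (inDZ t%:C%C hv)) => z.
  by rewrite hornerD hornerZ mulrDl addrAC mulrA.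
exists (P + t%:C%C *: Q) => //; rewrite (leq_trans (size_polyD _ _)) // geq_max sP.
by rewrite (leq_trans (size_scale_leq _ _)).
Qed.

(* With u = shift b, the orthogonality says that ||u||^2 + ||u - v||^2 = ||v||^2;
   but termwise, after shifting the terms of ||u||^2 by one index,
   the left-hand side dominates. *)
Lemma orthogonal_shift_eq0 z b v : modc z ^+ 2 < (3 / 2) `^ alpha ->
  ell2 b -> ell2 v -> (forall k, v k.+1 = z * b k.+1) ->
  sums (fun k => rdot (shift b k - v k) (shift b k) * w k) 0 ->
  forall k, b k = 0.
Proof.
move=> hz hb hv vE orth; set u := shift b.
have hu : ell2 u by exact: ell2_shift.
have huv : ell2 (fun k => u k - v k).
  have := ell2D hu (ell2Z (z := -1) hv).
  by congr ell2; apply/funext => k; rewrite mulN1r.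
have Xsum : sums (fun k => modc (b k) ^+ 2 * w k.+1) (sqnorm u).
  apply/(sumsS (fun k => modc (u k) ^+ 2 * w k)).
  by rewrite /= modc0 expr0n mul0r add0r.
have := sumsD Xsum (sumsD huv (sumsZ (-1) hv)).
set l := _ + (_ + _) => dsum.
(* Before reindexing, the sum is twice the inner product of u - v with u. *)
have l0 : l = 0.
  have := sumsD hu (sumsD huv (sumsZ (-1) hv)).
  have := sumsZ 2 orth; rewrite mulr0 => h0 h1; apply: (sums_unique _ h0).
  move: h1; congr (sums _ _); apply/funext => k.
  rewrite -/u rdotE !modc_sq.
  by case: (u k) (v k) => p q [r s] /=; ring.
rewrite l0 in dsum.
have gap k : modc z ^+ 2 * w k.+1 < w k.+2.
  apply: lt_le_trans (weight_ratio alpha_lt0 k).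
  by rewrite ltr_pM2r // weight_gt0.
have d0 := sums_ge0_eq0 _ dsum.
have dE k : modc (b k.+1) ^+ 2 * w k.+2 +
    (modc (u k.+1 - v k.+1) ^+ 2 * w k.+1 + -1 * (modc (v k.+1) ^+ 2 * w k.+1)) =
    modc (b k.+1) ^+ 2 * (w k.+2 - modc z ^+ 2 * w k.+1) +
    modc (u k.+1 - v k.+1) ^+ 2 * w k.+1.
  by rewrite vE modcM; ring.
(* At index 0, u vanishes and v_0 cancels, so v_0 may be arbitrary; this leaves room for the
   constant term of the approximant. *)
have dE0 : modc (b 0%N) ^+ 2 * w 1%N +
    (modc (u 0%N - v 0%N) ^+ 2 * w 0%N + -1 * (modc (v 0%N) ^+ 2 * w 0%N)) =
    modc (b 0%N) ^+ 2 * w 1%N.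
  by rewrite /u /= sub0r modcN; ring.
have {}d0 : forall k, modc (b k) ^+ 2 * w k.+1 + (modc (u k - v k) ^+ 2 * w k +
    -1 * (modc (v k) ^+ 2 * w k)) = 0.
  apply: d0 => -[|k]; first by rewrite dE0 term_ge0.
  by rewrite dE addr_ge0 ?term_ge0 // mulr_ge0 ?sqr_ge0 // subr_ge0 ltW.
have sq_eq0 (m : Cplx R) (r : R) : 0 < r -> modc m ^+ 2 * r <= 0 -> m = 0.
  move=> r0; rewrite pmulr_lle0 // => h; apply/eqP; rewrite -modc_eq0 -sqrf_eq0.
  by rewrite eq_le h sqr_ge0.
case=> [|k]; first by apply: (sq_eq0 _ (w 1%N)); rewrite ?weight_gt0 // -dE0 d0.
apply: (sq_eq0 _ (w k.+2 - modc z ^+ 2 * w k.+1)); first by rewrite subr_gt0.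
by rewrite -(d0 k.+1) dE lerDl term_ge0.
Qed.

End Dalpha.

(** * The zero-free disk *)

Theorem theorem5p3 (R : realType) (alpha : R) (alpha_lt0 : alpha < 0)
    (f : Cplx R -> Cplx R) (fD : Dspace alpha f) (f0_neq0 : f 0 != 0) (n : nat) :
  (forall p : Cplx R -> Cplx R, is_opt_approximant alpha f n p ->
     forall z : Cplx R, p z = 0 -> ~ (modc z < (3 / 2) `^ (alpha / 2))) /\
  (forall k : Cplx R -> Cplx R -> Cplx R, is_weighted_kernel alpha f n k ->
     forall z : Cplx R, k z 0 = 0 -> ~ (modc z < (3 / 2) `^ (alpha / 2))).
Proof.
pose a := taylor f.
have fa : inD alpha f a by [].
(* [Q * 'X] has the same size as P, hence is an admissible test polynomial. *)
have factor (P : {poly Cplx R}) z : (size P <= n.+1)%N -> P.[z] = 0 ->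
    exists2 Q : {poly Cplx R}, (size (Q * 'X)%R <= n.+1)%N & P = Q * ('X - z%:P).
  move=> sP /eqP/factor_theorem[Q PE]; exists Q => //.
  have [->|Q0] := eqVneq Q 0; first by rewrite mul0r size_poly0.
  by rewrite size_mulX //; move: sP; rewrite PE size_Mmonic ?monicXsubC // size_XsubC addn2.
have bound (z : Cplx R) : modc z < (3 / 2) `^ (alpha / 2) ->
    modc z ^+ 2 < (3 / 2) `^ alpha.
  by apply: lt_powR_half_sq; exact: modc_ge0.
split.
  move=> p opt z pz /bound zlt.
  have [[P sP pE] _] := opt; subst p.
  have [Q sQ PE] := factor _ _ sP pz.
  have [b hb] := inD_poly alpha_lt0 Q fa.
  (* Coefficients of z g + 1 with g = Q f, so that P f - 1 = X g - (z g + 1); the 1 only affects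
     index 0. *)
  pose y : (Cplx R)^nat := fun k => z * b k + delta R k.
  have hx : inD alpha (fun z => (Q * 'X).[z] * f z) (shift b).
    by apply: inD_eq (inDX alpha_lt0 hb) => t; rewrite hornerMX -mulrA mulrCA.
  have hy : inD alpha (fun t => z * (Q.[t] * f t) + 1) y.
    exact: inDD (inDZ z hb) (inD1 alpha).
  have hu : inD alpha (fun t => P.[t] * f t - 1) (fun k => shift b k + -1 * y k).
    apply: inD_eq (inDD (inDX alpha_lt0 hb) (inDZ (-1) hy)) => t.
    by rewrite PE hornerM hornerXsubC; ring.
  have b0 : forall k, b k = 0.
    apply: (orthogonal_shift_eq0 alpha_lt0 zlt (proj2 hb) (proj2 hy)).
      by move=> k; rewrite /y addr0.
    have := opt_orthogonal opt sP sQ hu hx.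
    by congr (sums _ _); apply/funext => k; rewrite mulN1r.
  (* Now g = 0, so the residual is -1. Its inner product with f / f(0), whose constant coefficient
     is 1, is -w_0, contradicting orthogonality. *)
  have hc : inD alpha (fun t => ((f 0)^-1)%:P.[t] * f t) (fun k => (f 0)^-1 * a k).
    by apply: inD_eq (inDZ _ fa) => t; rewrite hornerC.
  have sc : (size ((f 0)^-1)%:P%R <= n.+1)%N by rewrite (leq_trans (size_polyC_leq1 _)).
  have := opt_orthogonal opt sP sc hu hc.
  suff -> : (fun k => rdot (shift b k + -1 * y k) ((f 0)^-1 * a k) * weight alpha k) =
      (fun k => if k is 0%N then - weight alpha 0%N else 0).
    move=> /(sums_unique (sums_delta _))/eqP.
    by rewrite oppr_eq0 gt_eqF // weight_gt0.
  apply/funext => -[|k]; rewrite /y /= !b0 !(mulr0, add0r).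
    by rewrite (inD_at0 fa) mulVf // mulr1 rdotE /=; ring.
  by rewrite rdotE /=; ring.
move=> k ker z kz /bound zlt.
have [[P sP kE] rep] := ker 0.
have {}rep (Q : {poly Cplx R}) u v : (size Q <= n.+1)%N -> inD alpha (fun z => Q.[z] * f z) v ->
    inD alpha (fun z => P.[z] * f z) u ->
    sums (fun k => rdot (v k) (u k) * weight alpha k) (complex.Re Q.[0]).
  move=> sQ hv hu; rewrite -(rep (horner Q)); last by exists Q.
  by rewrite kE; exact: Ddot_Re hv hu.
have Pz : P.[z] = 0 by rewrite -kz -[LHS]/(horner P z) -kE.
have [Q sQ PE] := factor _ _ sP Pz.
have [b hb] := inD_poly alpha_lt0 Q fa.
have hx : inD alpha (fun z => (Q * 'X).[z] * f z) (shift b).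
  by apply: inD_eq (inDX alpha_lt0 hb) => t; rewrite hornerMX -mulrA mulrCA.
have hu : inD alpha (fun t => P.[t] * f t) (fun k => shift b k + - z * b k).
  apply: inD_eq (inDD (inDX alpha_lt0 hb) (inDZ (- z) hb)) => t.
  by rewrite PE hornerM hornerXsubC; ring.
have b0 : forall k, b k = 0.
  apply: (orthogonal_shift_eq0 alpha_lt0 zlt (proj2 hb) (ell2Z (z := z) (proj2 hb))) => //.
  (* The test polynomial X Q vanishes at 0, so reproduction gives orthogonality. *)
  have := rep _ _ _ sQ hx hu; rewrite hornerMX mulr0.
  congr (sums _ _); apply/funext => j; rewrite !rdotE mulNr.
  by congr (_ * _); ring.
(* Now P f = 0, yet reproducing the constant 1 must give 1. *)
have h1 : inD alpha (fun t => 1%:P.[t] * f t) a.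
  by apply: inD_eq fa => t; rewrite hornerC mul1r.
have s1 : (size (1%:P : {poly Cplx R}) <= n.+1)%N by rewrite (leq_trans (size_polyC_leq1 _)).
have := rep _ _ _ s1 h1 hu; rewrite hornerC.
(* The zero sequence is put in the shape of [sums_delta]. *)
suff -> : (fun j => rdot (a j) (shift b j + - z * b j) * weight alpha j) =
    (fun j => if j is 0%N then 0 else 0).
  by move=> /(sums_unique (sums_delta _))/eqP; rewrite eq_sym oner_eq0.
by apply/funext => -[|j]; rewrite /= !b0 mulr0 addr0 rdotE /=; ring.
Qed.
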